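(* Let $\mathcal{I}$ be a nontrivial admissible ideal of subsets of $\mathbb{N}$. A function $g:(\mathbb{R},\mathfrak{T}_{\mathcal{I}})\to(\mathbb{R},\mathfrak{T}_U)$ is continuous if and only if $g$ is $\mathcal{I}$-approximately continuous at every $x\in\mathbb{R}$.
   Context: $m$ denotes Lebesgue measure on $\mathbb{R}$ and $\mathfrak{T}_U$ the usual topology of $\mathbb{R}$. An ideal $\mathcal{I}$ of subsets of $\mathbb{N}=\{1,2,\dots\}$ is a nonempty family closed under finite unions and under subsets; it is nontrivial if $\mathcal{I}\neq\{\emptyset\}$ and $\mathbb{N}\notin\mathcal{I}$, and admissible if it contains all singletons. $\mathcal{F}(\mathcal{I})=\{M\subset\mathbb{N}:\mathbb{N}\setminus M\in\mathcal{I}\}$. For a bounded real sequence $x=(x_n)$: $\mathcal{I}\text{-}\limsup x=\sup\{b\in\mathbb{R}:\{k:x_k>b\}\notin\mathcal{I}\}$ and $\mathcal{I}\text{-}\liminf x=\inf\{a\in\mathbb{R}:\{k:x_k<a\}\notin\mathcal{I}\}$. Let $E\subset\mathbb{R}$ be Lebesgue measurable and $p\in\mathbb{R}$. Consider sequences $(J_n)_{n\in\mathbb{N}}$ of closed intervals with $p\in J_n$ for all $n$ and $\{n\in\mathbb{N}:0<m(J_n)<\frac1n\}\in\mathcal{F}(\mathcal{I})$. For such a sequence put $x_n=\frac{m(J_n\cap E)}{m(J_n)}$ (with $x_n:=0$ if $m(J_n)\in\{0,\infty\}$; such $n$ form a set in $\mathcal{I}$ and do not matter). The upper $\mathcal{I}$-density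 $\mathcal{I}\text{-}d^-(p,E)$ is the supremum of $\mathcal{I}\text{-}\limsup x_n$ over all such sequences $(J_n)$, and the lower $\mathcal{I}$-density $\mathcal{I}\text{-}d_-(p,E)$ is the infimum of $\mathcal{I}\text{-}\liminf x_n$ over all such sequences. If they are equal, the common value is the $\mathcal{I}$-density $\mathcal{I}\text{-}d(p,E)$. $\mathfrak{T}_{\mathcal{I}}$ (the $\mathcal{I}$-density topology on $\mathbb{R}$) is the collection of Lebesgue measurable sets $A\subset\mathbb{R}$ with $\mathcal{I}\text{-}d_-(x,A)=1$ for all $x\in A$. A function $f:\mathbb{R}\to\mathbb{R}$ is $\mathcal{I}$-approximately continuous at $x_0$ if there is a Lebesgue measurable set $E_{x_0}$ (containing $x_0$) such that $\mathcal{I}\text{-}d(x_0,E_{x_0})=1$ and $f|_{E_{x_0}}$ is continuous at $x_0$. *)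

(* Defs.v *)
From mathcomp Require Import all_boot all_order all_algebra.
From mathcomp Require Import all_classical all_reals all_analysis.

Set Implicit Arguments.
Unset Strict Implicit.
Unset Printing Implicit Defensive.
Import Order.TTheory GRing.Theory Num.Theory.
Import numFieldNormedType.Exports.

Local Open Scope classical_set_scope.
Local Open Scope ring_scope.

(* Pitfall: the index set {1, 2, ...} is represented by [nat], where [n : nat]
   stands for the positive integer n + 1. Hence 1/n becomes [n.+1%:R^-1]. *)
Record is_ideal (I : set_system nat) : Prop := IsIdeal {
  ideal_nonempty : I !=set0 ;
  ideal_setU : forall A B, I A -> I B -> I (A `|` B) ;
  ideal_subset : forall A B, A `<=` B -> I B -> I A
}.

Definition nontrivial_ideal (I : set_system nat) : Prop :=
  I <> [set set0] /\ ~ I setT.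

Definition admissible_ideal (I : set_system nat) : Prop :=
  forall n, I [set n].

Definition dual_filter (I : set_system nat) : set_system nat :=
  [set M | I (~` M)].

Definition I_limsup (R : realType) (I : set_system nat) (x : nat -> R)
    : \bar R :=
  ereal_sup [set b%:E | b in [set b : R | ~ I [set k | b < x k]]].

Definition I_liminf (R : realType) (I : set_system nat) (x : nat -> R)
    : \bar R :=
  ereal_inf [set a%:E | a in [set a : R | ~ I [set k | x k < a]]].

(* The sigma-algebra of Lebesgue measurable sets (not only the Borel sets):
   Caratheodory measurability for the Lebesgue outer measure, which is the
   domain of [completed_lebesgue_measure]. *)
Definition lebesgue_measurable (R : realType) (A : set R) : Prop :=
  ((@wlength R idfun)^*)%mu.-cara.-measurable A.

Definition leb (R : realType) (A : set R) : \bar R :=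
  completed_lebesgue_measure A.

(* Degenerate and unbounded closed intervals are allowed. *)
Definition admissible_intervals (R : realType) (I : set_system nat) (p : R)
    (J : nat -> set R) : Prop :=
  (forall n, [/\ is_interval (J n), closed (J n) & J n p]) /\
  dual_filter I [set n | (0 < leb (J n) < (n.+1%:R^-1)%:E)%E].

(* Since [fine +oo = 0] and [x / 0 = 0], the ratio is 0 whenever m(J n) is 0 or
   infinite. *)
Definition density_ratio (R : realType) (E : set R) (J : nat -> set R)
    (n : nat) : R :=
  fine (leb (J n `&` E)) / fine (leb (J n)).

Definition upper_I_density (R : realType) (I : set_system nat) (p : R)
    (E : set R) : \bar R :=
  ereal_sup [set I_limsup I (density_ratio E J) |
              J in admissible_intervals I p].

Definition lower_I_density (R : realType) (I : set_system nat) (p : R)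
    (E : set R) : \bar R :=
  ereal_inf [set I_liminf I (density_ratio E J) |
              J in admissible_intervals I p].

(* The I-density is partial, hence a relation: it exists and equals d. *)
Definition has_I_density (R : realType) (I : set_system nat) (p : R)
    (E : set R) (d : \bar R) : Prop :=
  upper_I_density I p E = d /\ lower_I_density I p E = d.

Definition I_density_open (R : realType) (I : set_system nat)
    : set_system R :=
  [set A | lebesgue_measurable A /\
           forall x, A x -> lower_I_density I x A = 1%E].

(* The library attaches a topology to its carrier type; here the topologies on
   domain and codomain are given as explicit families of open sets. *)
Definition continuous_for (X Y : Type) (TX : set_system X)
    (TY : set_system Y) (f : X -> Y) : Prop :=
  forall U, TY U -> TX (f @^-1` U).

Definition I_approx_continuous_at (R : realType) (I : set_system nat)
    (f : R -> R) (x0 : R) : Prop :=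
  exists E : set R,
    [/\ lebesgue_measurable E, E x0, has_I_density I x0 E 1%E &
        f @ within E (nbhs x0) --> f x0].

(* Main.v *)
Require Import Defs.
From mathcomp Require Import all_boot all_order all_algebra.
From mathcomp Require Import all_classical all_reals all_analysis.
Import numFieldNormedType.Exports.
Import Order.TTheory GRing.Theory Num.Theory.
From mathcomp Require Import lra.

(** The ideal turns out to be irrelevant: for a measurable set [E], the lower
    ideal density of [E] at [p] is one exactly when [E] has full density at [p]
    in the classical sense (lemma [lower_I_density1P]). If the classical density
    fails, one can choose a single bad interval for every index, so that all
    indices are bad and the whole index set is not in the ideal. Conversely,
    under full density only finitely many indices outside the exceptional set of
    an admissible sequence are bad, and finite sets belong to the ideal. Hence the
    theorem is the classical one for the density topology, and its two directions
    rest on two facts about points of full density.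

    A continuous function [g] provides, for each point, a decreasing sequence of
    measurable sets of full density, the preimages of shrinking balls around
    the value of [g]. A diagonal construction ([density_one_diagonal]) glues
    them into one set of full density contained in each of them near the point;
    this set witnesses approximate continuity.

    Conversely, if [g] is approximately continuous everywhere, the preimage of an
    open set contains, around each of its points, a measurable set of full density
    there. The remaining difficulty is measurability of the preimage, which comes
    from the Lebesgue density theorem ([measurable_of_density_one]): the preimage
    differs from a measurable kernel by points at which the kernel has full density
    without containing them, and these form a null set. *)

Set Implicit Arguments.
Unset Strict Implicit.
Unset Printing Implicit Defensive.

Local Open Scope classical_set_scope.
Local Open Scope ring_scope.

(** * Lebesgue outer measure and Lebesgue measurable sets *)

Section LebesgueOuterMeasure.
Context {R : realType}.
Implicit Types (A B E J : set R) (p r : R).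

Lemma lebE A : leb A = lebesgue_measure A.
Proof. by []. Qed.

Lemma leb_ge0 A : (0 <= leb A)%E.
Proof. exact: (outer_measure_ge0 ((@wlength R idfun)^*)%mu). Qed.

Lemma leb0 : leb (set0 : set R) = 0%E.
Proof. exact: (outer_measure0 ((@wlength R idfun)^*)%mu). Qed.

Lemma le_leb A B : A `<=` B -> (leb A <= leb B)%E.
Proof. exact: (le_outer_measure ((@wlength R idfun)^*)%mu). Qed.

Lemma leb_bigcup_le (F : nat -> set R) :
  (leb (\bigcup_n F n) <= \sum_(i <oo) leb (F i))%E.
Proof. exact: (outer_measure_sigma_subadditive ((@wlength R idfun)^*)%mu). Qed.

Lemma leb_setU_le A B : (leb (A `|` B) <= leb A + leb B)%E.
Proof. exact: (outer_measureU2 ((@wlength R idfun)^*)%mu). Qed.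

Lemma leb_setDE E A : lebesgue_measurable E ->
  leb A = (leb (A `&` E) + leb (A `\` E))%E.
Proof. by move=> mE; rewrite setDE; exact: mE. Qed.

Lemma leb_bigcup_null (F : nat -> set R) :
  (forall n, leb (F n) = 0%E) -> leb (\bigcup_n F n) = 0%E.
Proof.
move=> F0; apply/eqP; rewrite eq_le leb_ge0 andbT.
by apply: (le_trans (leb_bigcup_le F)); rewrite eseries0.
Qed.

Lemma measurable_lebesgue_measurable (A : set (measurableTypeR R)) :
  measurable A -> lebesgue_measurable (A : set R).
Proof. exact: sub_caratheodory. Qed.

Lemma open_lebesgue_measurable A : open A -> lebesgue_measurable A.
Proof.
move=> oA; apply: measurable_lebesgue_measurable.
exact: measurable_realfun.open_measurable.
Qed.

Lemma lebesgue_measurableI A B :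
  lebesgue_measurable A -> lebesgue_measurable B ->
  lebesgue_measurable (A `&` B).
Proof. exact: caratheodory_measurable_setI. Qed.

Lemma lebesgue_measurableU A B :
  lebesgue_measurable A -> lebesgue_measurable B ->
  lebesgue_measurable (A `|` B).
Proof. exact: caratheodory_measurable_setU. Qed.

Lemma lebesgue_measurableC A :
  lebesgue_measurable A -> lebesgue_measurable (~` A).
Proof. exact: caratheodory_measurable_setC. Qed.

Lemma lebesgue_measurable_bigcap (F : nat -> set R) :
  (forall n, lebesgue_measurable (F n)) -> lebesgue_measurable (\bigcap_n F n).
Proof.
move=> mF; rewrite -[X in lebesgue_measurable X]setCK setC_bigcap.
apply: lebesgue_measurableC; apply: caratheodory_measurable_bigcup => n.
exact/lebesgue_measurableC/mF.
Qed.

Lemma null_lebesgue_measurable A : leb A = 0%E -> lebesgue_measurable A.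
Proof.
move=> A0; apply: le_caratheodory_measurable => X.
rewrite [X in (X + _ <= _)%E](_ : _ = 0%E).
  by rewrite add0e; apply: le_leb; exact: subIsetl.
apply/eqP; rewrite eq_le outer_measure_ge0 andbT -A0.
by apply: le_leb; exact: subIsetr.
Qed.

(** Bounds how far a short interval can reach from one of its points, without
    describing the interval by its endpoints. *)
Lemma leb_interval_ge J p x : is_interval J -> J p -> J x ->
  (`|x - p|%:E <= leb J)%E.
Proof.
move=> iJ Jp Jx; pose a := Num.min p x; pose b := Num.max p x.
have -> : `|x - p|%:E = leb `[a, b].
  rewrite lebE lebesgue_measure_itv /= lte_fin /a /b.
  case: (ltgtP p x) => [px|xp|->].
  - by rewrite px -EFinB gtr0_norm ?subr_gt0.
  - by rewrite xp -EFinB ltr0_norm ?subr_lt0// opprB.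
  - by rewrite ltxx subrr normr0.
apply: le_leb => z /=; rewrite in_itv/= => zab.
apply: (iJ a b _ _ z zab); rewrite /a /b; case: (leP p x) => //.
Qed.

Lemma leb_closed_ball_le p r (A : set R) : 0 <= r ->
  A `<=` closed_ball p r -> (leb A <= (r *+ 2)%:E)%E.
Proof.
by move=> r0 /le_leb; rewrite [X in (_ <= X)%E]lebE lebesgue_measure_closed_ball.
Qed.

Lemma is_intervalI A B : is_interval A -> is_interval B -> is_interval (A `&` B).
Proof.
by move=> iA iB x y [Ax Bx] [Ay By] z xyz; split; [apply: (iA x y)|apply: (iB x y)].
Qed.

Lemma is_interval_closed_ball p r : 0 < r -> is_interval (closed_ball p r).
Proof. by move=> r0; rewrite closed_ball_itv//; exact: interval_is_interval. Qed.

(** The complement of [K] is a union of measurable hulls of the bounded pieces of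
    the complement of [A]; each hull has finite measure, so a measurable subset
    of [A] can meet it only in a null set. *)
Lemma exists_measurable_kernel A : exists K : set (measurableTypeR R),
  [/\ measurable K, K `<=` A & forall E, lebesgue_measurable E -> E `<=` A ->
      leb (E `\` K) = 0%E].
Proof.
pose X n := ~` A `&` ball (0 : R) n%:R.
have XE n : exists H : set (measurableTypeR R),
    [/\ measurable H, X n `<=` H & leb H = leb (X n)].
  have [G [oG XG GX]] := outer_measure_Gdelta (X n).
  exists (\bigcap_i G i); split => //.
  by apply: bigcapT_measurable => i; exact: measurable_realfun.open_measurable.
have [H HP] := choice XE.
exists (~` \bigcup_n H n); split.
- apply: measurableC; apply: bigcupT_measurable => n.
  by have [] := HP n.
- move=> x /= nHx; apply: contrapT => nAx; apply: nHx.
  exists (Num.truncn `|x|).+1 => //; have [_ XH _] := HP (Num.truncn `|x|).+1.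
  apply: XH; split => //; rewrite -ball_normE /= sub0r normrN.
  exact: truncnS_gt.
move=> E mE EA; rewrite setDE setCK setI_bigcupr; apply: leb_bigcup_null => n.
have [mH XH lH] := HP n.
have Hfin : leb (X n) \is a fin_num.
  rewrite ge0_fin_numE ?leb_ge0//; apply: (@le_lt_trans _ _ (leb (ball (0:R) n%:R))).
    by apply: le_leb; exact: subIsetr.
  by rewrite lebE lebesgue_measure_ball ?ltry.
have := leb_setDE (H n) mE; rewrite lH => e.
have le1 : (leb (X n) <= leb (H n `\` E))%E.
  apply: le_leb => y Xy; split; first exact: XH.
  by move=> /EA Ay; case: Xy.
apply/eqP; rewrite eq_le leb_ge0 andbT setIC.
have := leeD2l (leb (H n `&` E)) le1; rewrite -e.
rewrite -[X in (_ <= X)%E]add0e leeD2rE//.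
Qed.

End LebesgueOuterMeasure.

(** * Points of full density *)

Section DensityOne.
Context {R : realType}.
Implicit Types (A B E J : set R) (p r : R).

(** Ordinary full density, phrased through the outer measure of the part of the
    interval that is missed, so that it makes sense for arbitrary sets [E] and
    involves no quotient. *)
Definition density_one p E : Prop :=
  forall e : R, 0 < e -> exists2 d : R, 0 < d &
    forall J, is_interval J -> closed J -> J p -> (leb J < d%:E)%E ->
      (leb (J `\` E) <= e%:E * leb J)%E.

Lemma sub_density_one p A B : A `<=` B -> density_one p A -> density_one p B.
Proof.
move=> AB dA e /dA[d d0 HA]; exists d => // J iJ cJ Jp Jd.
by apply: le_trans (HA J iJ cJ Jp Jd); apply: le_leb; exact: setDS.
Qed.

Lemma density_oneI p A B :
  density_one p A -> density_one p B -> density_one p (A `&` B).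
Proof.
move=> dA dB e e0; have e20 : 0 < e / 2 by rewrite divr_gt0.
have [a a0 HA] := dA _ e20; have [b b0 HB] := dB _ e20.
exists (Num.min a b) => [|J iJ cJ Jp]; first by rewrite lt_min a0.
rewrite EFin_min lt_min => /andP[Ja Jb]; rewrite setDIr.
apply: (le_trans (leb_setU_le _ _)).
rewrite [e]splitr EFinD ge0_muleDl ?lee_fin ?(ltW e20)//.
by apply: leeD; [exact: HA|exact: HB].
Qed.

Lemma density_one_ball p r : 0 < r -> density_one p (ball p r).
Proof.
move=> r0 e e0; exists r => // J iJ cJ Jp Jr.
suff -> : J `\` ball p r = set0.
  by rewrite leb0 mule_ge0 ?leb_ge0// lee_fin ltW.
rewrite -subset0 => y [Jy]; apply; rewrite -ball_normE /= distrC.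
by rewrite -lte_fin; apply: le_lt_trans Jr; exact: leb_interval_ge.
Qed.

Lemma density_one_ae p A B : leb (A `\` B) = 0%E ->
  density_one p A -> density_one p B.
Proof.
move=> AB0 dA e /dA[d d0 HA]; exists d => // J iJ cJ Jp Jd.
apply: le_trans (HA J iJ cJ Jp Jd).
apply: (@le_trans _ _ (leb ((J `\` A) `|` (A `\` B)))).
  by apply: le_leb => y [Jy nBy]; have [Ay|nAy] := pselect (A y); [right|left].
by apply: (le_trans (leb_setU_le _ _)); rewrite AB0 adde0.
Qed.

(** The set agrees with [A n] within distance [r n] of [p], where [r n] is so small
    that a short interval loses at most the fraction [2 ^- n.+1] of its length
    through [A n]. A short interval [J] inside the ball of radius [r N] then loses
    at most the sum of these fractions over [n >= N]: the radii cut [J] down to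
    smaller intervals around [p], to which the bound for [A n] applies. *)
Lemma density_one_diagonal p (A : nat -> set R) :
  (forall n m, (n <= m)%N -> A m `<=` A n) ->
  (forall n, lebesgue_measurable (A n)) ->
  (forall n, A n p) ->
  (forall n, density_one p (A n)) ->
  exists E, [/\ lebesgue_measurable E, E p, density_one p E &
    forall n, exists2 r, 0 < r & E `&` ball p r `<=` A n].
Proof.
move=> decA mA Ap dA.
have c0 n : 0 < 1 / (2 ^ n.+1)%:R :> R by rewrite divr_gt0// ltr0n expn_gt0.
have /choice[r rP] n : exists r : R, 0 < r /\
    forall J, is_interval J -> closed J -> J p -> (leb J < (r *+ 3)%:E)%E ->
      (leb (J `\` A n) <= (1 / (2 ^ n.+1)%:R)%:E * leb J)%E.
  have [d d0 H] := dA n _ (c0 n).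
  (* The strict bound [3 r] leaves room for the closed ball, of length [2 r]. *)
  exists (d / 3); split; first by rewrite divr_gt0.
  by move=> J iJ cJ Jp; rewrite (_ : (d / 3) *+ 3 = d); [exact: H|lra].
have r0 n : 0 < r n by have [] := rP n.
pose E := \bigcap_n (A n `|` ~` closed_ball p (r n)).
exists E; split.
- apply: lebesgue_measurable_bigcap => n; apply: lebesgue_measurableU => //.
  by apply: open_lebesgue_measurable; apply: closed_openC; exact: closed_ball_closed.
- by move=> n _; left.
- move=> e e0; have [N Ne] : exists N, 1 / (2 ^ N)%:R < e.
    have [N _ HN] := near_infty_natSinv_expn_lt (PosNum e0).
    by exists N; rewrite natrX; apply: (HN N) => /=.
  exists (r N) => // J iJ cJ Jp JN.
  have lJ : leb J \is a fin_num.
    by rewrite ge0_fin_numE ?leb_ge0//; exact: lt_trans (ltry (r N)).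
  have JB y : J y -> closed_ball p (r N) y.
    move=> Jy; rewrite closed_ballE//; rewrite /closed_ball_ /= distrC -lee_fin.
    by apply: le_trans (ltW JN); exact: leb_interval_ge.
  pose F k := (J `&` closed_ball p (r (N + k)%N)) `\` A (N + k)%N.
  apply: (@le_trans _ _ (leb (\bigcup_k F k))).
    apply: le_leb => y [Jy]; rewrite /E => /existsNP[n /not_implyP[_]].
    move=> /not_orP[nAy /contrapT By].
    (* A point missed because of [A n] with [n <= N] is missed by [A N] too. *)
    have [nN|/ltnW Nn] := leqP n N.
      exists 0%N => //; rewrite /F addn0; split; first by split => //; exact: JB.
      by move=> /(decA _ _ nN).
    by exists (n - N)%N => //; rewrite /F subnKC.
  apply: (le_trans (leb_bigcup_le _)).
  have sumE := epsilon_trick0 xpredT (fine_ge0 (leb_ge0 J)).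
  apply: (@le_trans _ _ ((1 / (2 ^ N)%:R)%:E * leb J)%E); last first.
    by rewrite lee_wpmul2r ?leb_ge0// lee_fin ltW.
  apply: (@le_trans _ _ (\sum_(i <oo)
      ((1 / (2 ^ N)%:R)%:E * (fine (leb J) / (2 ^ i.+1)%:R)%:E))%E).
    apply: lee_nneseries => [i _ _|i _]; first exact: leb_ge0.
    have [_ /(_ (J `&` closed_ball p (r (N + i)%N))) H] := rP (N + i)%N.
    apply: (le_trans (H _ _ _ _)).
    + by apply: is_intervalI => //; exact: is_interval_closed_ball.
    + by apply: closedI => //; exact: closed_ball_closed.
    + by split => //; exact: closed_ballxx.
    + apply: (@le_lt_trans _ _ (r (N + i)%N *+ 2)%:E).
        by apply: (@leb_closed_ball_le _ p); [exact: ltW|exact: subIsetr].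
      by rewrite lte_fin ltr_pMn2l.
    apply: (@le_trans _ _ ((1 / (2 ^ (N + i).+1)%:R)%:E * leb J)%E).
      apply: lee_wpmul2l; first by rewrite lee_fin ltW.
      by apply: le_leb; exact: subIsetl.
    rewrite -{1}(fineK lJ) -!EFinM lee_fin -addnS expnD natrM !mul1r invfM.
    by rewrite -!mulrA [_^-1 * fine _]mulrC.
  rewrite nneseriesZl//; last first.
    by move=> i _; rewrite lee_fin divr_ge0// fine_ge0// leb_ge0.
  by rewrite lee_wpmul2l ?lee_fin ?divr_ge0//; rewrite -[X in (_ <= X)%E]fineK.
- move=> n; exists (r n) => // y [Ey /subset_closed_ball By].
  by case: (Ey n I).
Qed.

(** Intervals containing [x] include the balls centred at [x], so full density
    forces the symmetric density to be at least [1 / 2] at [x], whereas by the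
    Lebesgue density theorem it is zero at almost every point outside [K]. *)
Lemma density_one_outside_null (K : set (measurableTypeR R)) :
  measurable K -> leb [set x | density_one x K /\ ~ K x] = 0%E.
Proof.
move=> mK; have [N [mN N0 HN]] := lebesgue_density mK.
apply/eqP; rewrite eq_le leb_ge0 andbT -N0 -lebE.
apply: le_leb => x [dK nKx]; apply: HN => /= cv.
move: cv; rewrite indicE memNset// => cv.
have h2 : 0 < 2^-1 :> R by rewrite invr_gt0.
have [d d0 Hd] := dK _ h2.
have /cv/= lt_half : ereal_nbhs (0%:E) (fun u : \bar R => (u < 2^-1%:E)%E).
  by apply: open_ereal_lt'; rewrite lte_fin.
near (0 : R)^'+ => r.
have r0 : 0 < r by near: r; exact: nbhs_right_gt.
have rd : r < d / 2 by near: r; apply: nbhs_right_lt; rewrite divr_gt0.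
have : (lebesgue_measure (K `&` ball x r) *
  (lebesgue_measure (ball x r))^-1 < 2^-1%:E)%E by near: r; exact: lt_half.
have cb : leb (closed_ball x r) = (r *+ 2)%:E.
  by rewrite lebE lebesgue_measure_closed_ball// ltW.
have b : leb (ball x r) = (r *+ 2)%:E by rewrite lebE lebesgue_measure_ball// ltW.
have cbK : (leb (closed_ball x r `\` K) <= 2^-1%:E * (r *+ 2)%:E)%E.
  rewrite -cb; apply: Hd.
  - exact: is_interval_closed_ball.
  - exact: closed_ball_closed.
  - exact: closed_ballxx.
  - by rewrite cb lte_fin; lra.
have lbK : (leb (ball x r `\` K) <= r%:E)%E.
  apply: (@le_trans _ _ (leb (closed_ball x r `\` K))).
    by apply: le_leb; apply: setSD; exact: subset_closed_ball.
  by apply: (le_trans cbK); rewrite -EFinM lee_fin; lra.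
have := leb_setDE (ball x r) (measurable_lebesgue_measurable mK).
rewrite b setIC => e.
rewrite -!lebE b.
move: lbK e; have : (0 <= leb (K `&` ball x r))%E by exact: leb_ge0.
have : (0 <= leb (ball x r `\` K))%E by exact: leb_ge0.
case: (leb (K `&` ball x r)) (leb (ball x r `\` K)) => [u| |] [v| |]//=.
rewrite !lee_fin => v0 u0 vr [e].
rewrite inver gt_eqF ?mulrn_wgt0// -EFinM lte_fin ltr_pdivrMr ?mulrn_wgt0//.
by lra.
Unshelve. all: by end_near. Qed.

(** A set which has, at each of its points, a measurable subset of full density
    there differs from its measurable kernel only by points at which the kernel
    has full density without containing them. *)
Lemma measurable_of_density_one A :
  (forall x, A x -> exists E,
    [/\ lebesgue_measurable E, E `<=` A & density_one x E]) ->
  lebesgue_measurable A.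
Proof.
move=> HA; have [K [mK KA HK]] := exists_measurable_kernel A.
have -> : A = K `|` (A `\` K) by rewrite setDUK.
apply: lebesgue_measurableU; first exact: measurable_lebesgue_measurable.
apply: null_lebesgue_measurable; apply/eqP; rewrite eq_le leb_ge0 andbT.
rewrite -(density_one_outside_null mK); apply: le_leb => x [Ax nKx]; split => //.
have [E [mE EA dE]] := HA x Ax.
by apply: density_one_ae dE; exact: HK.
Qed.

End DensityOne.

(** * The ideal density equals one exactly at the points of full density *)

Section IdealDensity.
Context {R : realType}.
Variable I : set_system nat.
Hypothesis idealI : is_ideal I.
Hypothesis nontrivialI : nontrivial_ideal I.
Hypothesis admissibleI : admissible_ideal I.
Implicit Types (E : set R) (J : nat -> set R) (p : R).

Lemma ideal_set0 : I set0.
Proof.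
by have [B IB] := ideal_nonempty idealI; exact: ideal_subset idealI _ _ _ IB.
Qed.

Lemma ideal_setTN : ~ I setT.
Proof. by case: nontrivialI. Qed.

Lemma ideal_below N : I [set n | (n < N)%N].
Proof.
elim: N => [|N IN].
  by apply: (ideal_subset idealI _ ideal_set0) => n /=; rewrite ltn0.
apply: (ideal_subset idealI _ (ideal_setU idealI IN (admissibleI N))) => n /=.
by rewrite ltnS leq_eqVlt => /predU1P[->|]; [right|left].
Qed.

(** Holds for every sequence of sets: a set of infinite measure has ratio zero
    because [fine +oo = 0]. *)
Lemma density_ratio_le1 E J n : density_ratio E J n <= 1.
Proof.
rewrite /density_ratio; have := leb_ge0 (J n).
have := leb_ge0 (J n `&` E); have := @le_leb _ _ _ (@subIsetl _ (J n) E).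
case: (leb (J n `&` E)) (leb (J n)) => [u| |] [v| |]//=;
  rewrite ?invr0 ?mulr0 ?ler01//.
rewrite !lee_fin => uv u0 v0; have [->|vn0] := eqVneq v 0.
  by rewrite invr0 mulr0.
by rewrite ler_pdivrMr ?mul1r// lt_neqAle eq_sym vn0.
Qed.

Lemma density_ratio_ge E J n (e : R) : lebesgue_measurable E ->
  (0 < leb (J n) < +oo)%E ->
  (leb (J n `\` E) <= e%:E * leb (J n))%E = (1 - e <= density_ratio E J n).
Proof.
move=> mE; rewrite /density_ratio (leb_setDE (J n) mE).
have := leb_ge0 (J n `&` E); have := leb_ge0 (J n `\` E).
case: (leb (J n `&` E)) (leb (J n `\` E)) => [u| |] [v| |]//=; last 3 first.
1-3: by move=> _ _; rewrite ?addey ?addye// ltxx andbF.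
rewrite -EFinD -EFinM !lee_fin lte_fin ltry andbT => v0 u0 uv0.
by rewrite ler_pdivlMr//; apply/idP/idP; lra.
Qed.

(** An index with small ratio belongs to the exceptional set of the sequence or to
    an initial segment, where [1 / k.+1] does not yet bound the length of the
    interval sharply enough; both sets lie in the ideal. *)
Lemma density_one_ratio p E J (a : R) : lebesgue_measurable E ->
  density_one p E -> admissible_intervals I p J -> a < 1 ->
  I [set k | density_ratio E J k < a].
Proof.
move=> mE dE [HJ IJ] a1.
have [d d0 Hd] : exists2 d : R, 0 < d & forall K : set R, is_interval K -> closed K ->
    K p -> (leb K < d%:E)%E -> (leb (K `\` E) <= (1 - a)%:E * leb K)%E.
  by apply: dE; rewrite subr_gt0.
have [N _ HN] := near_infty_natSinv_lt (PosNum d0).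
apply: (ideal_subset idealI _ (ideal_setU idealI IJ (ideal_below N))) => k /=.
move=> ka; apply: contrapT => /not_orP[/contrapT/= /andP[Jk0 Jk] /negP]; rewrite -leqNgt.
move=> Nk; move: ka; rewrite ltNge => /negP; apply.
have {1}-> : a = 1 - (1 - a) by lra.
rewrite -density_ratio_ge//; last by rewrite Jk0 (lt_trans Jk) ?ltry.
have [iJ cJ Jp] := HJ k; apply: Hd => //.
by apply: (lt_trans Jk); rewrite lte_fin; exact: HN.
Qed.

Lemma admissible_intervals_exist p : exists J, admissible_intervals I p J.
Proof.
exists (fun n => [set` `[p, p + n.+2%:R^-1]]); split => [n|].
  split; [exact: interval_is_interval|exact: interval_closed|].
  by rewrite /= in_itv/= lexx/= lerDl.
apply: (ideal_subset idealI _ ideal_set0) => n [] /=.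
rewrite lebE lebesgue_measure_itv /= lte_fin ltrDl invr_gt0 ltr0n /=.
rewrite -EFinB addrAC subrr add0r !lte_fin invr_gt0 ltr0n /=.
by rewrite ltf_pV2 ?posrE// ltr_nat.
Qed.

Lemma upper_I_density_le1 p E : (upper_I_density I p E <= 1)%E.
Proof.
apply: ge_ereal_sup => _ [J _ <-]; apply: ge_ereal_sup => _ [b /= nIb <-].
rewrite lee_fin leNgt; apply/negP => b1; apply: nIb.
apply: (ideal_subset idealI _ ideal_set0) => k /= bk.
by have := lt_le_trans (lt_trans b1 bk) (density_ratio_le1 E J k); rewrite ltxx.
Qed.

Lemma I_liminf_ratio_le1 E J : (I_liminf I (density_ratio E J) <= 1)%E.
Proof.
apply/lee_addgt0Pr => e e0; apply: ge_ereal_inf; exists (1 + e)%:E => //=.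
exists (1 + e) => //= Ik; apply: ideal_setTN.
apply: (ideal_subset idealI _ Ik) => k _ /=.
by apply: (le_lt_trans (density_ratio_le1 E J k)); rewrite ltrDl.
Qed.

(** If the ordinary density is not one, choosing the
    [n]-th interval of length less than [1 / n.+1] among those on which [E]
    misses a fixed fraction bounds the ratio away from [1] at every index. The converse is
    [density_one_ratio]; an admissible sequence must exist for the infimum not to
    be [+oo]. *)
Lemma lower_I_density1P p E : lebesgue_measurable E ->
  lower_I_density I p E = 1%E <-> density_one p E.
Proof.
move=> mE; split=> [d1|dE].
  move=> e e0; apply: contrapT => noJ.
  have /choice[J HJ] n : exists K : set R,
      [/\ is_interval K, closed K, K p, (leb K < n.+1%:R^-1%:E)%E &
        ~ (leb (K `\` E) <= e%:E * leb K)%E].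
    apply: contrapT => noK; apply: noJ; exists n.+1%:R^-1; rewrite ?invr_gt0//.
    move=> K iK cK Kp Kn; apply: contrapT => nle; apply: noK; by exists K.
  have J0 n : (0 < leb (J n) < n.+1%:R^-1%:E)%E.
    have [_ _ _ -> nle] := HJ n; rewrite andbT lt_neqAle leb_ge0 andbT.
    apply/negP => /eqP J0; apply: nle; rewrite -J0 mule0 J0.
    by apply: le_leb; exact: subDsetl.
  have aJ : admissible_intervals I p J.
    split=> [n|]; first by have [] := HJ n.
    by apply: (ideal_subset idealI _ ideal_set0) => n /=; rewrite J0.
  have : (lower_I_density I p E <= (1 - e)%:E)%E.
    apply: ge_ereal_inf; exists (I_liminf I (density_ratio E J)); first by exists J.
    apply: ge_ereal_inf; exists (1 - e)%:E => //; exists (1 - e) => //= Ik.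
    apply: ideal_setTN; apply: (ideal_subset idealI _ Ik) => k _ /=.
    have [_ _ _ _ nle] := HJ k; rewrite ltNge -density_ratio_ge//; first exact/negP.
    by have /andP[-> /lt_trans->] := J0 k; rewrite ?ltry.
  by rewrite d1 lee_fin lerBrDl gerDr leNgt e0.
apply/eqP; rewrite eq_le; apply/andP; split.
  have [J aJ] := admissible_intervals_exist p.
  apply: ge_ereal_inf; exists (I_liminf I (density_ratio E J)); first by exists J.
  exact: I_liminf_ratio_le1.
apply: le_ereal_inf_tmp => _ [J aJ <-]; apply: le_ereal_inf_tmp => _ [a /= nIa <-].
rewrite lee_fin leNgt; apply/negP => a1; apply: nIa.
exact: density_one_ratio aJ a1.
Qed.

Lemma density_one_upper p E : lebesgue_measurable E ->
  density_one p E -> upper_I_density I p E = 1%E.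
Proof.
move=> mE dE; apply/eqP; rewrite eq_le upper_I_density_le1 /=.
have [J aJ] := admissible_intervals_exist p.
apply: (@le_trans _ _ (I_limsup I (density_ratio E J))); last first.
  by apply: ereal_sup_ubound; exists J.
apply/lee_addgt0Pr => e e0; rewrite -leeBlDr//.
apply: ereal_sup_ubound; exists (1 - e) => //= Ik; apply: ideal_setTN.
have I2 : I [set k | density_ratio E J k < 1 - e / 2].
  by apply: (density_one_ratio mE dE aJ); lra.
apply: (ideal_subset idealI _ (ideal_setU idealI Ik I2)) => k _ /=.
by have [h|h] := ltP (1 - e) (density_ratio E J k); [left|right; lra].
Qed.

Lemma has_I_density1P p E : lebesgue_measurable E ->
  has_I_density I p E 1%E <-> density_one p E.
Proof.
move=> mE; split=> [[_ /(lower_I_density1P p mE)]//|dE].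
by split; [exact: density_one_upper|exact/lower_I_density1P].
Qed.

Lemma I_density_openP E : I_density_open I E <->
  lebesgue_measurable E /\ (forall x, E x -> density_one x E).
Proof.
by split=> -[mE dE]; split => // x /dE; rewrite lower_I_density1P.
Qed.

End IdealDensity.

(** * Continuity and approximate continuity *)

Section Continuity.
Context {R : realType}.
Variable I : set_system nat.
Hypothesis idealI : is_ideal I.
Hypothesis nontrivialI : nontrivial_ideal I.
Hypothesis admissibleI : admissible_ideal I.
Variable g : R -> R.

Lemma continuous_I_approx_continuous x :
  continuous_for (I_density_open I) (open : set_system R) g ->
  I_approx_continuous_at I g x.
Proof.
move=> gc; pose A n := g @^-1` ball (g x) n.+1%:R^-1.
have Ax n : A n x by exact: ballxx.
have oA n : lebesgue_measurable (A n) /\ forall y, A n y -> density_one y (A n).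
  by apply/(I_density_openP idealI nontrivialI admissibleI)/gc/ball_open.
have decA n m : (n <= m)%N -> A m `<=` A n.
  move=> nm y; apply: le_ball; rewrite lef_pV2 ?posrE//.
  by rewrite ler_nat ltnS.
have [E [mE Ex dE EA]] := density_one_diagonal decA (fun n => (oA n).1) Ax
  (fun n => (oA n).2 x (Ax n)).
exists E; split => //; first exact/(has_I_density1P idealI nontrivialI admissibleI).
apply/cvgrPdist_lt => e e0.
have [n _ Hn] := near_infty_natSinv_lt (PosNum e0).
have [r r0 Er] := EA n.
apply/nbhs_ballP; exists r => //= y xy Ey.
have := Er y (conj Ey xy); rewrite /A -ball_normE /= => /lt_trans; apply.
exact: (Hn n (leqnn n)).
Qed.

Lemma I_approx_continuous_continuous :
  (forall x, I_approx_continuous_at I g x) ->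
  continuous_for (I_density_open I) (open : set_system R) g.
Proof.
move=> gE U oU; apply/(I_density_openP idealI nontrivialI admissibleI).
have loc x : U (g x) -> exists E,
    [/\ lebesgue_measurable E, E `<=` g @^-1` U & density_one x E].
  move=> Ux; have [E [mE Ex dE cg]] := gE x.
  have /cg/nbhs_ballP[r r0 Hr] : nbhs (g x) U by exact: open_nbhs_nbhs.
  exists (E `&` ball x r); split.
  - by apply: lebesgue_measurableI => //; exact/open_lebesgue_measurable/ball_open.
  - by move=> y [Ey xy]; exact: Hr.
  - apply: density_oneI; last exact: density_one_ball.
    exact/(has_I_density1P idealI nontrivialI admissibleI).
split; first exact: measurable_of_density_one.
by move=> x /loc[E [_ EU]]; exact: sub_density_one.
Qed.

End Continuity.

Theorem theorem5p14 (R : realType) (I : set_system nat)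
    (idealI : is_ideal I) (nontrivialI : nontrivial_ideal I)
    (admissibleI : admissible_ideal I) (g : R -> R) :
  continuous_for (I_density_open I) (open : set_system R) g <->
  (forall x : R, I_approx_continuous_at I g x).
Proof.
split=> [gc x|]; first exact: continuous_I_approx_continuous.
exact: I_approx_continuous_continuous.
Qed.
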